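(* Let $B=\{(j,s): 0\le j\le m-1,\ s\in\{+,-\},\ r_{j,s}>0\}$ be the set of active signed row branches. Suppose there is a non-empty open interval $I\subset(0,1)$ such that $g_{j,s}(I)\subset I$ for all $(j,s)\in B$ and the intervals $g_{j,s}(I)$ are pairwise disjoint for distinct $(j,s)\in B$. Then $$\dim_{\mathrm H} K=\frac{1}{\log m}\log\left(\sum_{(j,s)\in B}r_{j,s}^{\beta}\right).$$
   Context: Let $2\le m<n$ be integers, let $D\subset\{0,\ldots,n-1\}\times\{0,\ldots,m-1\}$ be a non-empty digit set, and put $\beta=\log m/\log n$. For each digit $d=(i,j)\in D$ choose signs $\sigma_d,\eta_d\in\{-1,1\}$ and define $$S_d(x,y)=\left(\frac{\sigma_d x+a_d}{n},\frac{\eta_d y+b_d}{m}\right),$$ where $a_d=i$ if $\sigma_d=1$ and $a_d=i+1$ if $\sigma_d=-1$; and $b_d=j$ if $\eta_d=1$ and $b_d=j+1$ if $\eta_d=-1$. The reflected carpet $K$ is the attractor of $\{S_d:d\in D\}$, i.e. the unique non-empty compact set $K\subset\mathbb R^2$ with $K=\bigcup_{d\in D}S_d(K)$. Put $r_{j,+}=\#\{i:(i,j)\in D,\ \eta_{(i,j)}=1\}$ and $r_{j,-}=\#\{i:(i,j)\in D,\ \eta_{(i,j)}=-1\}$. The signed row branches are the maps of $\mathbb R$ $$g_{j,+}(y)=\frac{y+j}{m},\qquad g_{j,-}(y)=\frac{j+1-y}{m}.$$ $\dim_{\mathrm H}$ denotes Hausdorff dimension. *)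

(* Defs.v *)
From mathcomp Require Import all_boot all_order all_algebra.
From mathcomp Require Import all_classical all_reals all_analysis.
Import Order.TTheory GRing.Theory Num.Theory.
Import numFieldNormedType.Exports.

Set Implicit Arguments.
Unset Strict Implicit.
Unset Printing Implicit Defensive.

Local Open Scope classical_set_scope.
Local Open Scope ring_scope.

Section Hausdorff.
Context {R : realType}.
Implicit Types (A U : set (R * R)) (s delta : R).

(* The normed structure MathComp-Analysis puts on R * R is the sup norm (with
   the same topology); Hausdorff measures are taken here for the Euclidean
   metric. *)
Definition edist (p q : R * R) : R :=
  Num.sqrt ((p.1 - q.1) ^+ 2 + (p.2 - q.2) ^+ 2).

(* diam set0 = -oo; the empty set is dealt with separately in hgauge. *)
Definition diam A : \bar R :=
  ereal_sup [set (edist u.1 u.2)%:E | u in A `*` A].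

(* (diam U)^s, with value 0 at the empty set and, since 0 `^ 0 = 1, value 1 at
   singletons when s = 0, so that the 0-dimensional measure counts points. *)
Definition hgauge s U : \bar R :=
  if `[< U = set0 >] then 0%E else poweR (diam U) s.

Definition hausdorff_premeasure s delta A : \bar R :=
  ereal_inf [set (\sum_(0 <= k <oo) hgauge s (U k))%E |
    U in [set U : nat -> set (R * R) |
      A `<=` \bigcup_k U k /\ forall k, (diam (U k) <= delta%:E)%E]].

Definition hausdorff_measure s A : \bar R :=
  ereal_sup [set hausdorff_premeasure s delta A | delta in [set d : R | 0 < d]].

Definition hausdorff_dim A : \bar R :=
  ereal_inf [set s%:E | s in [set s : R | 0 <= s /\ hausdorff_measure s A = 0%E]].

End Hausdorff.

Section ReflectedCarpet.
Context {R : realType} (n m : nat).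

(* Signs are booleans: false stands for + (the sign 1) and true for - (the sign
   -1), so that the sign encoded by b is (-1) ^+ b. *)
Definition sign_map (N k : nat) (b : bool) (t : R) : R :=
  ((-1) ^+ b * t + (if b then k.+1 else k)%:R) / N%:R.

Definition carpet_map (sigma eta : 'I_n * 'I_m -> bool) (d : 'I_n * 'I_m)
    (p : R * R) : R * R :=
  (sign_map n d.1 (sigma d) p.1, sign_map m d.2 (eta d) p.2).

Definition is_attractor (D : {set 'I_n * 'I_m})
    (S : 'I_n * 'I_m -> R * R -> R * R) (K : set (R * R)) : Prop :=
  [/\ K !=set0, compact K & K = \bigcup_(d in [set` D]) (S d @` K)].

Definition row_branch (js : 'I_m * bool) (y : R) : R :=
  if js.2 then (js.1.+1%:R - y) / m%:R else (y + js.1%:R) / m%:R.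

Definition row_count (D : {set 'I_n * 'I_m}) (eta : 'I_n * 'I_m -> bool)
    (js : 'I_m * bool) : nat :=
  #|[pred i : 'I_n | ((i, js.1) \in D) && (eta (i, js.1) == js.2)]|.

Definition active_branches (D : {set 'I_n * 'I_m})
    (eta : 'I_n * 'I_m -> bool) : {set 'I_m * bool} :=
  [set js | (0 < row_count D eta js)%N].

End ReflectedCarpet.

(* Main.v *)
(* Write Z for the sum of r^beta over the active branches.

   Upper bound.  Weight the approximate square with column word t and remaining
   row word v by the product of r^(beta-1) over t times that of r^beta over v;
   the weights at level k add up to Z^k.  Every point of K lies, at one of a
   bounded number of levels, in an approximate square of weight at least
   e^(-eps k), so these squares give finite covers with arbitrarily small
   Hausdorff sums for every exponent above log Z / log m.

   Lower bound.  Among the row words of a large length q, those with a fixed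
   number of occurrences of each branch all have the same number R of column
   words, and by pigeonhole some choice of the occurrence numbers gives a set W
   of words with |W| R^beta >= Z^q / (q+1)^#B.  The subsystem of these blocks has
   uniform fibres, so counting words yields dimension at least
   log (|W| R^beta) / (q log m), the interval condition ensuring that a set of
   diameter m^(-qk) meets boundedly many approximate squares. *)

Require Import Defs.
From mathcomp Require Import all_boot all_order all_algebra.
From mathcomp Require Import all_classical all_reals all_analysis.
From mathcomp Require Import finmap ring lra.
Import Order.TTheory GRing.Theory Num.Theory.
Import numFieldNormedType.Exports.

Local Open Scope classical_set_scope.
Local Open Scope ring_scope.

Set Implicit Arguments.
Unset Strict Implicit.
Unset Printing Implicit Defensive.

(** * Words of similitudes and packing *)

Section Words.
Context {R : realType}.
Implicit Types (f g : R -> R) (c : R).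

(** Only [|a|] is prescribed, so orientation-reversing branches are included. *)
Definition similitude c g : Prop :=
  exists a t : R, `|a| = c /\ forall x, g x = a * x + t.

Lemma similitude_dist c g x y :
  similitude c g -> `|g x - g y| = c * `|x - y|.
Proof.
move=> [a [t [<- gE]]]; rewrite !gE -normrM; congr (`|_|); ring.
Qed.

Lemma similitude_inj c g : 0 < c -> similitude c g -> injective g.
Proof.
move=> c0 sg x y gxy; have := similitude_dist x y sg.
rewrite gxy subrr normr0 => /esym/eqP.
by rewrite mulf_eq0 gt_eqF //= normr_eq0 subr_eq0 => /eqP.
Qed.

Lemma similitude_comp c c' f g :
  similitude c f -> similitude c' g -> similitude (c * c') (f \o g).
Proof.
move=> [a [t [<- fE]]] [a' [t' [<- gE]]].
exists (a * a'), (a * t' + t); rewrite normrM; split=> // x.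
by rewrite /= fE gE; ring.
Qed.

(** The images of []a, b[] are open intervals of length [c * (b - a)] centred at the images of the
    midpoint. Were the two centres closer than that length, the point [p] halfway between them would
    lie in both images. *)
Lemma similitude_separation c f g a b : 0 < c -> a < b ->
  similitude c f -> similitude c g ->
  (forall x y, a < x < b -> a < y < b -> f x != g y) ->
  c * (b - a) <= `|f ((a + b) / 2) - g ((a + b) / 2)|.
Proof.
move=> c0 ab sf sg fg; rewrite leNgt; apply/negP => lt_mid.
pose p := (f ((a + b) / 2) + g ((a + b) / 2)) / 2.
have hit h : similitude c h -> `|p - h ((a + b) / 2)| < c * (b - a) / 2 ->
    exists2 x, a < x < b & h x = p.
  move=> [u [t [uc hE]]] lt_p.
  have u0 : u != 0 by rewrite -normr_eq0 uc gt_eqF.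
  exists ((p - t) / u); last by rewrite hE; field.
  have : `|(p - t) / u - (a + b) / 2| < (b - a) / 2.
    rewrite -(ltr_pM2l c0) -{1}uc -normrM.
    have -> : u * ((p - t) / u - (a + b) / 2) = p - h ((a + b) / 2).
      by rewrite hE; field.
    by rewrite mulrA.
  by rewrite ltr_norml => /andP[lo hi]; apply/andP; split; lra.
have fp : `|p - f ((a + b) / 2)| < c * (b - a) / 2.
  move: lt_mid; rewrite /p !ltr_norml => /andP[lo hi].
  by apply/andP; split; lra.
have gp : `|p - g ((a + b) / 2)| < c * (b - a) / 2.
  move: lt_mid; rewrite /p !ltr_norml => /andP[lo hi].
  by apply/andP; split; lra.
have [x xab fx] := hit f sf fp; have [y yab gy] := hit g sg gp.
by have := fg x y xab yab; rewrite fx gy eqxx.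
Qed.

(** The first letter acts last, so prefixes of a word name the nested cells containing the image. *)
Definition word_map {E : Type} (f : E -> R -> R) (s : seq E) : R -> R :=
  foldr (fun e h => f e \o h) id s.

Lemma word_map_cat {E : Type} (f : E -> R -> R) (s t : seq E) x :
  word_map f (s ++ t) x = word_map f s (word_map f t x).
Proof. by elim: s => //= e s ->. Qed.

Lemma word_map_similitude {E : Type} (f : E -> R -> R) c s :
  (forall e, similitude c (f e)) -> similitude (c ^+ size s) (word_map f s).
Proof.
move=> sf; elim: s => [|e s IH] /=.
  by exists 1, 0; rewrite normr1 expr0; split=> // x; rewrite mul1r addr0.
by rewrite exprS; apply: similitude_comp.
Qed.

Lemma word_map_in {E : Type} (f : E -> R -> R) (J : set R) s x :
  (forall e y, J y -> J (f e y)) -> J x -> J (word_map f s x).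
Proof. by move=> fJ Jx; elim: s => //= e s IH; apply: fJ. Qed.

(** The common prefix is injective, and at the first letter where the words differ the two branches
    have disjoint images of [J]. Disjointness is asked only for letters in the same row [rho]; a
    constant [rho] covers the case where all letters are separated. *)
Lemma word_map_disjoint {E B : eqType} (rho : E -> B) (f : E -> R -> R) c
    (J : set R) (s s' : seq E) x y :
  0 < c -> (forall e, similitude c (f e)) ->
  (forall e y, J y -> J (f e y)) ->
  (forall e e' y y', e != e' -> rho e = rho e' -> J y -> J y' ->
     f e y != f e' y') ->
  size s = size s' -> s != s' -> map rho s = map rho s' -> J x -> J y ->
  word_map f s x != word_map f s' y.
Proof.
move=> c0 sf fJ dis; elim: s s' => [|e s IH] [|e' s'] //= [sz].
rewrite eqseq_cons negb_and => /orP ne [rhoe rhos] Jx Jy.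
have [ee'|ee'] := eqVneq e e'; last by apply: dis => //; exact: word_map_in.
move: ne; rewrite ee' eqxx => -[//|ne].
rewrite (inj_eq (similitude_inj c0 (sf e'))); exact: IH.
Qed.

(** Pigeonhole: half-open cells of length [h] starting at [lo] contain at most one point each. *)
Lemma separated_size {T : eqType} (X : seq T) (z : T -> R) (h lo w : R) :
  0 < h -> 0 <= w -> uniq X ->
  (forall x y, x \in X -> y \in X -> x != y -> h <= `|z x - z y|) ->
  (forall x, x \in X -> lo <= z x <= lo + w * h) ->
  (size X <= (Num.truncn w).+1)%N.
Proof.
move=> h0 w0 uX sep zX.
pose q x := Num.truncn ((z x - lo) / h).
have q0 x : x \in X -> 0 <= (z x - lo) / h.
  by move=> /zX/andP[lo_le _]; rewrite divr_ge0 ?subr_ge0 // ltW.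
have uq : uniq (map q X).
  rewrite map_inj_in_uniq // => x y xX yX qxy; apply/eqP/negPn/negP => ne.
  have := sep x y xX yX ne; apply/negP; rewrite -ltNge.
  have /andP[x1 x2] := truncn_itv (q0 x xX).
  have /andP[y1 y2] := truncn_itv (q0 y yX).
  move: x1 x2 y1 y2; rewrite -/(q x) -/(q y) qxy.
  rewrite !ler_pdivlMr // !ltr_pdivrMr // -natr1 mulrDl mul1r => *.
  by rewrite ltr_norml; apply/andP; split; lra.
rewrite -(size_map q) -(size_iota 0 (Num.truncn w).+1).
apply: uniq_leq_size => // _ /mapP[x xX ->].
rewrite mem_iota /= add0n ltnS; apply: le_truncn.
by have /andP[_] := zX x xX; rewrite ler_pdivrMr //; lra.
Qed.

End Words.

(** * Hausdorff measure and the mass distribution principle *)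

Section HausdorffCriteria.
Context {R : realType}.
Implicit Types (U K : set (R * R)) (t : R).

Lemma exprn_eventually_lt (z e : R) (k0 : nat) : 0 <= z < 1 -> 0 < e ->
  exists2 k, (k0 <= k)%N & z ^+ k < e.
Proof.
move=> /andP[z0 z1] e0.
have /cvg_expr /cvgrPdist_lt /(_ e e0) [N _ HN] : `|z| < 1 by rewrite ger0_norm.
exists (maxn k0 N); first exact: leq_maxl.
have := HN (maxn k0 N) (leq_maxr _ _).
by rewrite sub0r normrN ger0_norm // exprn_ge0.
Qed.

Lemma edist_ge_coord (p r : R * R) :
  `|p.1 - r.1| <= Defs.edist p r /\ `|p.2 - r.2| <= Defs.edist p r.
Proof.
by split; rewrite -sqrtr_sqr ler_wsqrtr // ?lerDl ?lerDr sqr_ge0.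
Qed.

Lemma edist_le_coord (p r : R * R) (d : R) :
  `|p.1 - r.1| <= d -> `|p.2 - r.2| <= d -> Defs.edist p r <= 2 * d.
Proof.
move=> h1 h2; have d0 : 0 <= d by apply: le_trans h1.
rewrite -(ger0_norm (mulr_ge0 (ler0n R 2) d0)) -sqrtr_sqr ler_wsqrtr //.
have := lerXn2r 2 (normr_ge0 _) d0 h1; have := lerXn2r 2 (normr_ge0 _) d0 h2.
by rewrite !real_normK ?num_real //; nra.
Qed.

Lemma edist_le_diam U p r : U p -> U r -> ((Defs.edist p r)%:E <= diam U)%E.
Proof. by move=> Up Ur; apply: ereal_sup_ubound; exists (p, r). Qed.

Lemma diam_ge0 U : U !=set0 -> (0 <= diam U)%E.
Proof.
move=> [p Up]; apply: le_trans (edist_le_diam Up Up).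
by rewrite lee_fin sqrtr_ge0.
Qed.

Lemma hgauge_ge0 t U : (0 <= hgauge t U)%E.
Proof. by rewrite /hgauge; case: ifP => // _; exact: poweR_ge0. Qed.

Lemma hgauge_le t U (d : R) : 0 <= t -> 0 <= d ->
  (forall p r, U p -> U r -> Defs.edist p r <= d) -> (hgauge t U <= (d `^ t)%:E)%E.
Proof.
move=> t0 d0 Ud; rewrite /hgauge; case: ifPn => [_|/asboolP U0].
  by rewrite lee_fin powR_ge0.
rewrite -poweR_EFin; apply: gt0_ler_poweR => //.
- by rewrite in_itv /= leey andbT; apply/diam_ge0/set0P/eqP.
- by rewrite in_itv /= leey lee_fin d0.
- by apply: ge_ereal_sup => _ [[p r] [/= Up Ur] <-]; rewrite lee_fin Ud.
Qed.

(* The slack [eta] is what lets a set of diameter zero be replaced by one of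
   positive size. *)
Lemma scale_for_set (M q t eta : R) U : 1 < M -> 0 < q < 1 -> 0 <= t ->
  q <= M `^ (- t) -> 0 < eta -> (diam U <= 1%:E)%E ->
  exists l, (diam U <= (M^-1 ^+ l)%:E)%E /\
    ((q ^+ l)%:E <= q^-1%:E * hgauge t U + eta%:E)%E.
Proof.
move=> M1 /andP[q0 q1] t0 qM eta0 U1.
have M0 : 0 < M by apply: lt_trans M1.
have Mi0 : 0 < M^-1 by rewrite invr_gt0.
have Mi1 : 0 <= M^-1 < 1 by rewrite ltW //= invf_lt1.
have gauge0 : (0 <= q^-1%:E * hgauge t U)%E.
  by rewrite mule_ge0 ?hgauge_ge0 // lee_fin invr_ge0 ltW.
(* Empty sets and single points fit every scale, so [l] is taken so large that [q ^+ l] is below the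
   slack. *)
have [dU|dU] := leP (diam U) 0%E.
  have q01 : 0 <= q < 1 by rewrite ltW.
  have [l _ lq] := exprn_eventually_lt 0 q01 eta0.
  exists l; split; first by rewrite (le_trans dU) // lee_fin exprn_ge0 ?ltW.
  by rewrite -[leLHS]add0e leeD // lee_fin ltW.
move: dU U1; case dE: (diam U) => [d| |] //; rewrite lte_fin lee_fin => d0 d1.
have exl : exists l, M^-1 ^+ l.+1 < d.
  have [l _ ld] := exprn_eventually_lt 0 Mi1 d0; exists l.
  apply: le_lt_trans ld; rewrite exprS ler_piMl ?exprn_ge0 //; first lra.
  by case/andP: Mi1 => _ /ltW.
(* Minimality places [d] between the powers [l.+1] and [l] of [M^-1]; the factor [q^-1] pays for
   this shift by one. *)
case: (ex_minnP exl) => l ld lmin; exists l; split.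
  rewrite lee_fin; case: l ld lmin => [|l] ld lmin; first by rewrite expr0.
  by rewrite leNgt; apply/negP => /lmin; rewrite ltnn.
have -> : hgauge t U = (d `^ t)%:E.
  rewrite /hgauge ifF ?dE ?poweR_EFin //; apply/asboolP => U0.
  by move: dE; rewrite U0 /diam setX0 image_set0 ereal_sup0.
rewrite -EFinM -EFinD lee_fin.
suff : q ^+ l.+1 <= d `^ t.
  by rewrite exprS mulrC -ler_pdivlMr // => h; rewrite mulrC; apply: ler_wpDr => //; apply/ltW.
apply: (@le_trans _ _ ((M^-1 ^+ l.+1) `^ t)); last first.
  by apply: ge0_ler_powR => //; rewrite ?nnegrE ?exprn_ge0 // ltW.
have -> : (M^-1 ^+ l.+1) `^ t = (M `^ (- t)) ^+ l.+1.
  rewrite -(powR_mulrn _ (ltW Mi0)) -(powR_inv1 (ltW M0)).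
  rewrite -(powR_mulrn _ (powR_ge0 M (- t))) -!powRrM.
  by rewrite mulN1r !mulNr mulrC.
by rewrite lerXn2r ?nnegrE ?powR_ge0 // ltW.
Qed.

Lemma compact_coord_bound K : compact K ->
  exists2 C, 0 <= C & forall p, K p -> `|p.1| <= C /\ `|p.2| <= C.
Proof.
move=> cK.
have [A [_ KA]] := @compact_bounded R ((R * R)%type : normedModType R) K cK.
have [C AC C0] : exists2 C, A < C & 0 <= C.
  by exists (`|A| + 1); rewrite ?addr_ge0 // (le_lt_trans (ler_norm _)) // ltrDl.
exists C => // p Kp; apply/andP.
by have := KA C AC p Kp; rewrite /Num.norm /= ge_max.
Qed.

Lemma log_ratio (n m : nat) : (1 < m)%N -> (m <= n)%N ->
  let beta : R := ln m%:R / ln n%:R in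
  [/\ 0 < beta, beta <= 1 & n%:R `^ beta = m%:R].
Proof.
move=> m1 mn beta; have n1 := leq_trans m1 mn.
have m0 : 0 < m%:R :> R by rewrite ltr0n ltnW.
have n0 : 0 < n%:R :> R by rewrite ltr0n ltnW.
have lnn : 0 < ln (n%:R : R) by rewrite ln_gt0 // ltr1n.
split; first by rewrite divr_gt0 // ln_gt0 // ltr1n.
  by rewrite ler_pdivrMr // mul1r ler_ln ?posrE // ler_nat.
by rewrite /powR gt_eqF // /beta divfK ?gt_eqF // lnK.
Qed.

Definition coord_thickness U (h : R) : Prop :=
  forall p r, U p -> U r -> `|p.1 - r.1| <= h /\ `|p.2 - r.2| <= h.

(* The mass distribution principle with the uniform probabilities on the finite
   samples [P k] in place of a measure: by compactness a cover may be taken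
   finite, and then a single deep level [k] sees all of its scales. *)
Lemma mass_distribution K (M q C t : R) (P : nat -> finType)
    (pt : forall k, P k -> R * R) :
  1 < M -> 0 < q < 1 -> 0 <= t -> q <= M `^ (- t) -> compact K ->
  (forall k, (0 < #|P k|)%N) -> (forall k x, K (pt k x)) ->
  (forall l k U, (l <= k)%N -> coord_thickness U (3 * M^-1 ^+ l) ->
     #|[set x | `[< U (pt k x) >]]%SET|%:R <= C * q ^+ l * #|P k|%:R) ->
  hausdorff_measure t K <> 0%E.
Proof.
move=> M1 q01 t0 qM cK P0 Kpt count.
have /andP[q0 q1] := q01.
have Mi0 : 0 < M^-1 by rewrite invr_gt0 (lt_trans _ M1).
(* The count at level 0 for a single sample point already has a positive left-hand side. *)
have C0 : 0 < C.
  have := count 0%N 0%N [set y | y = pt 0%N (enum_val (Ordinal (P0 0%N)))] (leqnn _).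
  have -> : 0 < C = (0 < C * q ^+ 0 * #|P 0%N|%:R).
    by rewrite expr0 mulr1 pmulr_lgt0 // ltr0n.
  move=> h; apply: lt_le_trans (h _); last first.
    by move=> _ _ -> ->; rewrite !subrr normr0 expr0; split; lra.
  rewrite ltr0n; apply/card_gt0P; exists (enum_val (Ordinal (P0 0%N))).
  by rewrite inE; apply/asboolP.
suff lb : ((q / (2 * C))%:E <= hausdorff_measure t K)%E.
  move=> h0; move: lb; rewrite h0 lee_fin leNgt => /negP; apply.
  by rewrite divr_gt0 // mulr_gt0.
apply: (@le_trans _ _ (hausdorff_premeasure t 1 K)); last first.
  by apply: ereal_sup_ubound; exists 1 => //; exact: ltr01.
apply: le_ereal_inf_tmp => _ [U [KU U1] <-].
rewrite leNgt; apply/negP => small.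
(* All slacks together stay below 1/(4C). With gauges summing to less than q/(2C), the sum of the
   [q ^+ l i] stays below 1/C, while counting samples will force it to be at least 1/C. *)
pose eta (i : nat) : R := (4 * C)^-1 * 2^-1 ^+ i.+1.
have eta0 i : 0 < eta i by rewrite mulr_gt0 ?exprn_gt0 ?invr_gt0 // mulr_gt0.
have /choice[l hl] : forall i, exists l, (diam (U i) <= (M^-1 ^+ l)%:E)%E /\
    ((q ^+ l)%:E <= q^-1%:E * hgauge t (U i) + (eta i)%:E)%E.
  by move=> i; exact: scale_for_set.
(* Enlarging each set by its own scale makes the cover open; the thickness grows from one to three
   times that scale. *)
pose V i : set (R * R) := \bigcup_(u in U i) ball u (M^-1 ^+ l i).
have VU i : coord_thickness (V i) (3 * M^-1 ^+ l i).
  move=> p r [u Uu [/= pu1 pu2]] [v Uv [/= rv1 rv2]].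
  have := le_trans (edist_le_diam Uu Uv) (hl i).1; rewrite lee_fin => uv.
  have [uv1 uv2] := edist_ge_coord u v.
  have {uv uv1}/ler_normlP[? ?] := le_trans uv1 uv.
  have {uv2}/ler_normlP[? ?] : `|u.2 - v.2| <= M^-1 ^+ l i.
    by apply: le_trans uv2 _; have := le_trans (edist_le_diam Uu Uv) (hl i).1; rewrite lee_fin.
  move: pu1 pu2 rv1 rv2; rewrite /ball /= => /ltr_normlP[? ?] /ltr_normlP[? ?]
    /ltr_normlP[? ?] /ltr_normlP[? ?].
  by split; apply/ler_normlP; split; lra.
have KV : K `<=` \bigcup_(i in setT) V i.
  move=> p /KU[i _ Up]; exists i => //; exists p => //.
  by apply: ballxx; rewrite exprn_gt0.
have : @cover_compact (R * R)%type K 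
  by rewrite -(@compact_cover ((R * R)%type : normedModType R)).
move=> /(_ nat setT V) [] //.
  by move=> i _; apply: bigcup_open => u _; exact: ball_open.
move=> D _ KD.
have [N ND] : exists N, forall i, [set` D] i -> (i < N)%N.
  exists (\max_(i <- finmap.enum_fset D) i).+1 => i iD.
  by rewrite ltnS; apply: leq_bigmax_seq.
(* The level must be at least every scale in the finite subcover for [count] to apply to each of its
   sets. *)
pose k := \max_(i < N) l i.
have lk (i : 'I_N) : (l i <= k)%N by exact: leq_bigmax.
pose X i := [set x | `[< V i (pt k x) >]]%SET.
have : (#|P k|%:R : R) <= \sum_(i < N) C * q ^+ l i * #|P k|%:R.
  apply: (@le_trans _ _ (\sum_(i < N) #|X i|%:R)); last first.
    by apply: ler_sum => i _; exact: count.
  rewrite -natr_sum ler_nat.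
  have -> : #|P k| = #|\bigcup_(i < N) X i|%SET.
    rewrite -cardsT; apply: eq_card => x; rewrite inE; apply/esym/finset.bigcupP.
    have [i /= iD Vi] := KD _ (Kpt k x).
    by exists (Ordinal (ND i iD)) => //; rewrite inE; apply/asboolP.
  elim/big_rec2: _ => [|i y Y _ IH]; first by rewrite cards0.
  by rewrite (leq_trans (leq_card_setU _ _)) // leq_add2l.
rewrite -mulr_suml -mulr_sumr -{1}[#|P k|%:R]mul1r ler_pM2r ?ltr0n //.
move=> le1.
have : ((\sum_(i < N) q ^+ l i)%:E <=
        \sum_(i < N) (q^-1%:E * hgauge t (U i) + (eta i)%:E))%E.
  by rewrite -sumEFin; apply: lee_sum => i _; exact: (hl i).2.
have etaN : \sum_(i < N) eta i < (2 * C)^-1 / 2.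
  have -> : (2 * C)^-1 / 2 = (4 * C)^-1 by field; rewrite gt_eqF.
  rewrite -mulr_sumr gtr_pMr ?invr_gt0 ?mulr_gt0 //.
  have -> : \sum_(i < N) (2^-1 : R) ^+ i.+1 = 1 - 2^-1 ^+ N.
    elim: (N) => [|n IH]; first by rewrite big_ord0 expr0 subrr.
    by rewrite big_ord_recr /= IH exprS; field.
  by rewrite ltrBlDr ltrDl exprn_gt0.
have gsum : ((\sum_(0 <= i < N) hgauge t (U i))%R < (q / (2 * C))%:E)%E.
  apply: le_lt_trans small; apply: nneseries_lim_ge => i _ _.
  exact: hgauge_ge0.
rewrite big_split /= -ge0_sume_distrr => [|i _]; last exact: hgauge_ge0.
rewrite big_mkord in gsum.
have : (0 <= \sum_(i < N) hgauge t (U i))%E.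
  by apply: sume_ge0 => i _; exact: hgauge_ge0.
move: gsum; case: (\sum_(i < N) hgauge t (U i))%E => [x| |] //.
rewrite lte_fin lee_fin sumEFin -EFinM -EFinD lee_fin => xq x0 le2.
have xq' : q^-1 * x < (2 * C)^-1 by rewrite ltr_pdivrMl // mulrC.
suff : \sum_(i < N) q ^+ l i < C^-1.
  by rewrite -(ltr_pM2l C0) divff ?gt_eqF // ltNge le1.
have -> : C^-1 = (2 * C)^-1 + ((2 * C)^-1 / 2) + ((2 * C)^-1 / 2).
  by field; rewrite gt_eqF.
apply: le_lt_trans le2 _; have : 0 < (2 * C)^-1 / 2.
  by rewrite divr_gt0 // invr_gt0 mulr_gt0.
by lra.
Qed.

End HausdorffCriteria.

(** * Lower bound for uniform fibres *)

Section UniformFibres.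
Context {R : realType}.

(** Sum the fibre sizes over the values of [p]. The values are prefixes of words, which form no
    finite type, so their number is bounded through duplicate-free lists. *)
Lemma card_le_fibres {T : finType} {T' : eqType} (A : {set T}) (p : T -> T')
    (c d : nat) :
  (forall Y, uniq Y -> (forall y, y \in Y -> exists2 x, x \in A & p x = y) ->
     (size Y <= c)%N) ->
  (forall y, (#|[set x in A | p x == y]%SET| <= d)%N) ->
  (#|A| <= c * d)%N.
Proof.
move=> Yc fib; pose Y := undup (map p (enum A)).
have szY : (size Y <= c)%N.
  apply: Yc => [|y]; first exact: undup_uniq.
  by rewrite mem_undup => /mapP[x]; rewrite mem_enum => xA ->; exists x.
apply: (@leq_trans (\sum_(y <- Y) d)%N); last first.
  by rewrite big_const_seq count_predT iter_addn_0 mulnC leq_mul2r szY orbT.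
apply: (@leq_trans (\sum_(y <- Y) #|[set x in A | p x == y]%SET|)%N); last first.
  exact: leq_sum.
rewrite -sum1_card; under [leqRHS]eq_bigr do rewrite -sum1_card.
rewrite (exchange_big_dep (mem A)) /= => [|y x _]; last by rewrite inE => /andP[].
apply: leq_sum => x xA; rewrite big_mkcond (bigD1_seq (p x)) ?undup_uniq //=.
- by rewrite inE xA eqxx leq_addr.
- by rewrite mem_undup map_f // mem_enum.
Qed.

(** The images of the midpoint are [c ^+ L * (b - a)] apart and within [(3 + lam) * c ^+ L] of [r],
    which leaves room for a number of them independent of [L]. The points [x] will come from the
    attractor and may lie outside []a, b[]; [lam] bounds how far. *)
Lemma word_packing {T E : eqType} (f : E -> R -> R) (c a b lam r : R)
    (Y : seq T) (om : T -> seq E) (L : nat) :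
  0 < c -> a < b -> 0 <= lam -> (forall e, similitude c (f e)) -> uniq Y ->
  (forall y, y \in Y -> size (om y) = L) ->
  (forall y y' x x', y \in Y -> y' \in Y -> y != y' ->
     a < x < b -> a < x' < b ->
     word_map f (om y) x != word_map f (om y') x') ->
  (forall y, y \in Y -> exists2 x, `|(a + b) / 2 - x| <= lam &
     `|word_map f (om y) x - r| <= 3 * c ^+ L) ->
  (size Y <= (Num.truncn (2 * (3 + lam) / (b - a))).+1)%N.
Proof.
move=> c0 ab lam0 sf uY szY dis near_r.
have cL0 : 0 < c ^+ L by rewrite exprn_gt0.
have ba0 : 0 < b - a by rewrite subr_gt0.
have sim y : y \in Y -> similitude (c ^+ L) (word_map f (om y)).
  by move=> /szY <-; exact: word_map_similitude.
apply: (@separated_size _ _ Y (fun y => word_map f (om y) ((a + b) / 2))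
  (c ^+ L * (b - a)) (r - (3 + lam) * c ^+ L)) => //.
- by rewrite mulr_gt0.
- by apply: divr_ge0; [rewrite mulr_ge0 // addr_ge0|exact: ltW].
- move=> y y' yY y'Y ne; apply: similitude_separation (sim _ yY) (sim _ y'Y) _ => //.
  by move=> x x'; exact: dis.
- move=> y yY; have [x xlam xr] := near_r y yY.
  have := similitude_dist ((a + b) / 2) x (sim y yY).
  have : c ^+ L * `|(a + b) / 2 - x| <= c ^+ L * lam by rewrite ler_pM2l.
  have -> : 2 * (3 + lam) / (b - a) * (c ^+ L * (b - a)) =
      2 * ((3 + lam) * c ^+ L) by field; rewrite gt_eqF.
  move: xr => /ler_normlP[? ?] ? e2.
  have /ler_normlP[? ?] : `|word_map f (om y) ((a + b) / 2) - word_map f (om y) x|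
    <= c ^+ L * lam by rewrite e2.
  by apply/andP; split; lra.
Qed.

Lemma card_tuple_prefix {T : finType} (k l : nat) (s : seq T) : (l <= k)%N ->
  (#|[set v : k.-tuple T | take l v == s]%SET| <= #|T| ^ (k - l))%N.
Proof.
move=> lk; rewrite -card_tuple.
apply: (@leq_card_in _ _ (fun v : k.-tuple T => [tuple of drop l v])).
move=> v v'; rewrite !inE => /eqP hv /eqP hv' /(congr1 val) /= hd.
by apply: val_inj; rewrite /= -(cat_take_drop l v) hd hv -hv' cat_take_drop.
Qed.

(* Sets of size [M^-l] meet boundedly many approximate squares, i.e. pairs of a
   row word of length [l] and a column word of length [L] with [N^L <= M^l];
   since all fibres have the same size, the uniform weight on words gives each
   of them the same mass. *)
Lemma uniform_fibre_measure_neq0 (W F : finType) (f : W * F -> R -> R)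
    (g : W -> R -> R) (N M : nat) (a b a' b' : R) (K : set (R * R)) (t : R) :
  (1 < M)%N -> (M <= N)%N -> (0 < #|W|)%N -> (0 < #|F|)%N ->
  (forall e, similitude N%:R^-1 (f e)) ->
  (forall w, similitude M%:R^-1 (g w)) ->
  a' < b' -> (forall e x, a' < x < b' -> a' < f e x < b') ->
  (forall e e' x x', e != e' -> e.1 = e'.1 -> a' < x < b' -> a' < x' < b' ->
     f e x != f e' x') ->
  a < b -> (forall w y, a < y < b -> a < g w y < b) ->
  (forall w w' y y', w != w' -> a < y < b -> a < y' < b -> g w y != g w' y') ->
  compact K -> K !=set0 -> (forall e p, K p -> K (f e p.1, g e.1 p.2)) ->
  0 <= t -> M%:R `^ t < #|W|%:R * #|F|%:R `^ (ln M%:R / ln N%:R) ->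
  hausdorff_measure t K <> 0%E.
Proof.
move=> M1 MN W0 F0 sf sg ab' fJ fdis ab gI gdis cK [p0 Kp0] Kinv t0.
set beta := ln M%:R / ln N%:R => tlt.
have M1R : 1 < M%:R :> R by rewrite ltr1n.
have N1R : 1 < N%:R :> R by rewrite ltr1n (leq_trans M1).
have M0 : 0 < M%:R :> R by rewrite (lt_trans _ M1R).
have N0 : 0 < N%:R :> R by rewrite (lt_trans _ N1R).
have W0R : 0 < #|W|%:R :> R by rewrite ltr0n.
have F0R : 0 < #|F|%:R :> R by rewrite ltr0n.
have F1R : 1 <= #|F|%:R :> R by rewrite ler1n.
have [beta0 beta1 Nbeta] : [/\ 0 < beta, beta <= 1 & N%:R `^ beta = M%:R]
  by exact: log_ratio.
have [lam [lam0 Klam]] : exists lam : R, 0 <= lam /\ forall p, K p ->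
    `|(a' + b') / 2 - p.1| <= lam /\ `|(a + b) / 2 - p.2| <= lam.
  have [B B0 KB] := compact_coord_bound cK.
  exists (B + `|(a' + b') / 2| + `|(a + b) / 2|); split; first by rewrite !addr_ge0.
  move=> p /KB[p1 p2].
  split; apply: (le_trans (ler_normB _ _)).
    by have := normr_ge0 ((a + b) / 2); lra.
  by have := normr_ge0 ((a' + b') / 2); lra.
pose Q := #|W|%:R * #|F|%:R `^ beta.
have Q0 : 0 < Q by rewrite mulr_gt0 // powR_gt0.
have Mt1 : 1 <= M%:R `^ t by rewrite -[leLHS](powRr0 (M%:R : R)); apply: ler_powR => //; exact: ltW.
have Q1 : 1 < Q by exact: le_lt_trans tlt.
pose c1 := (Num.truncn (2 * (3 + lam) / (b - a))).+1.
pose c2 := (Num.truncn (2 * (3 + lam) / (b' - a'))).+1.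
pose pt k (x : k.-tuple W * k.-tuple F) : R * R :=
  (word_map f (zip x.1 x.2) p0.1, word_map g x.1 p0.2).
have Kword v u : size v = size u ->
    K (word_map f (zip v u) p0.1, word_map g v p0.2).
  elim: v u => [|w v IH] [|i u] //=; first by rewrite -surjective_pairing.
  move=> [sz]; exact: (Kinv (w, i) _ (IH _ sz)).
(* Here [c1] bounds the row prefixes met by a small set, [c2] the column prefixes over each of them,
   and the factor [#|F|] absorbs the rounding of the column length [L]. *)
apply: (@mass_distribution R K M%:R Q^-1 (c1 * c2 * #|F|)%:R t
  (fun k => (k.-tuple W * k.-tuple F)%type) pt) => //.
- by rewrite invr_gt0 Q0 invf_lt1.
- by rewrite powRN lef_pV2 ?posrE ?powR_gt0 // ltW.
- by move=> k; rewrite card_prod !card_tuple muln_gt0 !expn_gt0 W0 F0.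
- by move=> k [v u]; apply: Kword; rewrite !size_tuple.
move=> l k U lk thickU.
set X := [set x | _]%SET.
have map_tt (s : seq W) : map (fun=> tt) s = nseq (size s) tt.
  by elim: s => //= _ s ->.
(* Rounding down makes the width [N^-L] at least the height [M^-l], so a set of thickness three
   heights is also at most three widths thick. *)
pose L := Num.truncn (beta * l%:R).
have /andP[Lle Lgt] : L%:R <= beta * l%:R < L.+1%:R.
  by apply: truncn_itv; rewrite mulr_ge0 // ltW.
have Ll : (L <= l)%N by rewrite -(ler_nat R) (le_trans Lle) // ler_piMl.
have Lk := leq_trans Ll lk.
have MNl : M%:R^-1 ^+ l <= N%:R^-1 ^+ L :> R.
  rewrite !exprVn lef_pV2 ?posrE ?exprn_gt0 // -Nbeta.
  rewrite -(powR_mulrn L (ltW N0)) -(powR_mulrn l (powR_ge0 _ _)) -powRrM.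
  by apply: ler_powR => //; exact: ltW.
have XU x : x \in X -> U (pt k x) by rewrite inE => /asboolP.
(* Fix first the row prefix of length [l], then the column prefix of length [L]; the remaining
   letters are free. *)
have cardX : (#|X| <= c1 * (c2 * (#|W| ^ (k - l) * #|F| ^ (k - L))))%N.
  apply: (@card_le_fibres _ _ X (fun x => take l x.1)) => [Y uY YX|s].
    (* One word [x0] of [X] supplies the reference point from which all the others are within the
       thickness. *)
    case: Y uY YX => [//|y0 Y] uY YX.
    have [x0 x0X _] := YX y0 (mem_head _ _).
    apply: (@word_packing _ _ g M%:R^-1 a b lam (pt k x0).2 (y0 :: Y) id l) => //.
    - by rewrite invr_gt0.
    - by move=> y /YX[x _ <-]; rewrite size_take_min size_tuple; apply/minn_idPl.
    - move=> y y' x x' /YX[z _ zy] /YX[z' _ zy'] ne hx hx'.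
      apply: (@word_map_disjoint R W unit (fun=> tt) g M%:R^-1
        [set y | a < y < b]) => //.
      + by rewrite invr_gt0.
      + by move=> w w' u u' ww' _; exact: gdis.
      + by rewrite -zy -zy' !size_take_min !size_tuple.
      + by rewrite !map_tt -zy -zy' !size_take_min !size_tuple.
    - move=> y /YX[[v u] xX <-] /=.
      exists (word_map g (drop l v) p0.2).
        have sz : size (drop l v) = size (drop l u) by rewrite !size_drop !size_tuple.
        by have [_] := Klam _ (Kword _ _ sz).
      rewrite -word_map_cat cat_take_drop.
      by have [] := thickU _ _ (XU _ xX) (XU _ x0X).
  set A := [set x in X | _]%SET.
  apply: (@card_le_fibres _ _ A (fun x => take L x.2)) => [Y uY YA|s'].
    case: Y uY YA => [//|y0 Y] uY YA.
    have [x0 x0A _] := YA y0 (mem_head _ _).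
    have szs : size s = l.
      by move: x0A; rewrite inE => /andP[_ /eqP <-]; rewrite size_take_min size_tuple; apply/minn_idPl.
    have szY y : y \in y0 :: Y -> size y = L.
      by move=> /YA[x _ <-]; rewrite size_take_min size_tuple; apply/minn_idPl.
    have szL : size (take L s) = L by rewrite size_take_min szs; apply/minn_idPl.
    apply: (@word_packing _ _ f N%:R^-1 a' b' lam (pt k x0).1 (y0 :: Y)
      (fun y => zip (take L s) y) L) => //.
    - by rewrite invr_gt0.
    - by move=> y /szY yL; rewrite size1_zip ?szL // yL.
    - move=> y y' x x' /szY yL /szY y'L ne hx hx'.
      apply: (@word_map_disjoint R _ W fst f N%:R^-1
        [set y | a' < y < b']) => //.
      + by rewrite invr_gt0.
      + by rewrite !size1_zip ?szL ?yL ?y'L.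
      + apply: contra ne => /eqP /(congr1 unzip2).
        by rewrite !unzip2_zip ?szL ?yL ?y'L // => ->.
      + by rewrite -[LHS]/(unzip1 _) -[RHS]/(unzip1 _) !unzip1_zip ?szL ?yL ?y'L.
    - move=> y /YA[[v u] xA <-] /=; have : (v, u) \in X by move: xA; rewrite inE => /andP[].
      move=> xX; have x0X : x0 \in X by move: x0A; rewrite inE => /andP[].
      have -> : take L s = take L v.
        by move: xA; rewrite inE => /andP[_ /eqP <-] /=; rewrite take_takel.
      exists (word_map f (zip (drop L v) (drop L u)) p0.1).
        have sz : size (drop L v) = size (drop L u) by rewrite !size_drop !size_tuple.
        by have [] := Klam _ (Kword _ _ sz).
      rewrite -word_map_cat -zip_cat ?cat_take_drop; last first.
        by rewrite !size_take_min !size_tuple.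
      have [h _] := thickU _ _ (XU _ xX) (XU _ x0X).
      by apply: le_trans h _; rewrite ler_pM2l.
  apply: (@leq_trans #|finset.setX [set v : k.-tuple W | take l v == s]
    [set u : k.-tuple F | take L u == s']|%SET).
    by apply/subset_leq_card/fintype.subsetP => -[v u]; rewrite finset.in_setX !inE /= => /andP[/andP[_ ->] ->].
  by rewrite cardsX leq_mul // card_tuple_prefix.
have : (#|X|%:R : R) <= (c1 * (c2 * (#|W| ^ (k - l) * #|F| ^ (k - L))))%:R.
  by rewrite ler_nat.
move=> /le_trans; apply.
rewrite card_prod !card_tuple.
have -> : (#|W| ^ k = #|W| ^ l * #|W| ^ (k - l))%N by rewrite -expnD subnKC.
have -> : (#|F| ^ k = #|F| ^ L * #|F| ^ (k - L))%N by rewrite -expnD subnKC.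
rewrite !natrM !natrX.
set w1 := _ ^+ (k - l); set w2 := _ ^+ (k - L).
(* After cancelling the powers of [#|W|] this is the inequality [beta * l <= L + 1] between
   exponents of [#|F|]. *)
have key : 1 <= #|F|%:R * Q^-1 ^+ l * (#|W|%:R ^+ l * #|F|%:R ^+ L).
  rewrite exprVn exprMn.
  have -> : #|F|%:R * (#|W|%:R ^+ l * (#|F|%:R `^ beta) ^+ l)^-1 *
     (#|W|%:R ^+ l * #|F|%:R ^+ L) = #|F|%:R ^+ L.+1 / (#|F|%:R `^ beta) ^+ l :> R.
    have W1 : #|W|%:R ^+ l != 0 :> R by rewrite expf_neq0 // gt_eqF.
    have cancelW (u w y z : R) : w != 0 -> u * (w * y)^-1 * (w * z) = u * z / y.
      move=> w0; rewrite invfM -[RHS]mul1r -(mulVf w0); ring.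
    by rewrite cancelW // exprS.
  rewrite ler_pdivlMr ?exprn_gt0 ?powR_gt0 // mul1r.
  rewrite -(powR_mulrn L.+1 (ltW F0R)) -(powR_mulrn l (powR_ge0 _ _)) -powRrM.
  by apply: ler_powR => //; exact: ltW.
have w10 : 0 <= w1 by rewrite exprn_ge0 // ltW.
have w20 : 0 <= w2 by rewrite exprn_ge0 // ltW.
have : 0 <= c1%:R * (c2%:R * (w1 * w2)) :> R by rewrite !mulr_ge0.
move=> /(ler_peMr) /(_ key) /le_trans; apply.
have rearrange (u1 u2 v x wl fl y1 y2 : R) :
    u1 * (u2 * (y1 * y2)) * (v * x * (wl * fl)) =
    u1 * u2 * v * x * (wl * y1 * (fl * y2)) by ring.
by rewrite rearrange.
Qed.

End UniformFibres.

(** * Lower bound in general *)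

Section LowerBound.
Context {R : realType}.

(** Bernoulli's inequality for the root [z = 1 + h] of [x] of order 2(d+1): once q h^2 > 1, q + 1 <
    (1 + q h)^2 <= z^(2q), and raising to the power d + 1 gives x^q on the right. *)
Lemma expr_beats_polynomial (x : R) (d : nat) : 1 < x ->
  exists q : nat, (0 < q)%N /\ q.+1%:R ^+ d < x ^+ q.
Proof.
move=> x1; pose z := x `^ (d.+1 * 2)%:R^-1.
have x0 : 0 <= x by rewrite ltW // (lt_trans _ x1).
have zx : z ^+ (d.+1 * 2) = x.
  by rewrite -powR_mulrn ?powR_ge0 // -powRrM mulVf ?pnatr_eq0 // powRr1.
have z1 : 1 < z.
  rewrite ltNge; apply/negP => zle; have := exprn_ile1 (d.+1 * 2) (powR_ge0 _ _) zle.
  by rewrite zx leNgt x1.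
pose h := z - 1; have h0 : 0 < h by rewrite subr_gt0.
pose q := (Num.truncn (h ^- 2)).+1.
have q_gt : h ^- 2 < q%:R by exact: truncnS_gt.
exists q; split=> //.
have bern k : 1 + k%:R * h <= z ^+ k.
  elim: k => [|k IH]; first by rewrite mul0r addr0 expr0.
  rewrite exprS; apply: (@le_trans _ _ (z * (1 + k%:R * h))).
    rewrite -natr1 {1}/z -/z (_ : z = 1 + h); last by rewrite /h; ring.
    have : 0 <= k%:R * h * h :> R by rewrite !mulr_ge0 // ltW.
    by lra.
  by rewrite ler_pM2l // (lt_trans _ z1).
have lt_q : q.+1%:R < z ^+ (q * 2).
  rewrite exprM; apply: (@lt_le_trans _ _ ((1 + q%:R * h) ^+ 2)); last first.
    rewrite lerXn2r ?nnegrE ?bern //.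
    by rewrite addr_ge0 // mulr_ge0 // ltW.
    by rewrite exprn_ge0 // powR_ge0.
  have : 1 < q%:R * h ^+ 2.
    by rewrite -ltr_pdivrMr ?exprn_gt0 // div1r.
  rewrite -natr1 => lt1.
  have : q%:R < q%:R * (q%:R * h ^+ 2) :> R by rewrite ltr_pMr ?ltr0n.
  have : 0 < q%:R * h by rewrite mulr_gt0 ?ltr0n.
  by nra.
have qd : 1 <= q.+1%:R :> R by rewrite ler1n.
have -> : x ^+ q = (z ^+ (q * 2)) ^+ d.+1.
  by rewrite -zx -!exprM; congr (_ ^+ _); rewrite -mulnA mulnC (mulnC q).
apply: (@le_lt_trans _ _ (q.+1%:R ^+ d.+1)); first by rewrite exprS ler_peMl // exprn_ge0.
by rewrite ltrXn2r ?nnegrE // exprn_ge0 // powR_ge0.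
Qed.

Lemma word_map_ifs {E B : Type} (rho : E -> B) (f : E -> R -> R)
    (g : B -> R -> R) (K : set (R * R)) (u : seq E) p :
  (forall e p, K p -> K (f e p.1, g (rho e) p.2)) -> K p ->
  K (word_map f u p.1, word_map g (map rho u) p.2).
Proof.
move=> Kinv Kp; elim: u => [|e u IH] /=; first by rewrite -surjective_pairing.
exact: (Kinv e _ IH).
Qed.

(** * Row words sorted by their letter counts, and the subsystem of a heavy count *)

Section Fibres.
Context {E B : finType} (rho : E -> B).

Definition fibre (b : B) : pred E := [pred e | rho e == b].

Lemma card_word_fibre (q : nat) (w : {ffun 'I_q -> B}) :
  #|[set u : {ffun 'I_q -> E} | [forall i, rho (u i) == w i]]%SET| =
  (\prod_i #|fibre (w i)|)%N.
Proof.
have -> : #|[set u : {ffun 'I_q -> E} | [forall i, rho (u i) == w i]]%SET| =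
    #|(family (fun i => fibre (w i)) : pred {ffun 'I_q -> E})|.
  apply: eq_card => u; rewrite inE; apply/forallP/familyP => h i.
    by rewrite inE.
  by have := h i; rewrite inE.
by rewrite card_family foldrE big_map big_enum.
Qed.

(** The type of a word in the sense of information theory; values in ['I_q.+1] make the types a
    finite type of cardinality (q+1)^#B. *)
Definition letter_count (q : nat) (w : {ffun 'I_q -> B}) : {ffun B -> 'I_q.+1} :=
  [ffun b => inord #|[pred i | w i == b]|].

Lemma prod_letters (q : nat) (w : {ffun 'I_q -> B}) (F : B -> nat) :
  (\prod_i F (w i) = \prod_b F b ^ letter_count w b)%N.
Proof.
rewrite (partition_big w xpredT) //=; apply: eq_bigr => b _.
under eq_bigr => i /eqP -> do [].
rewrite prod_nat_const ffunE inordK // ltnS.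
by rewrite -[leqRHS](card_ord q) max_card.
Qed.

(* There are at most [(q+1)^#|B|] letter counts, so one of them carries the
   whole sum up to a factor that is subexponential in [q]. *)
Lemma heavy_letter_count (x : B -> R) (q : nat) :
  exists tau : {ffun B -> 'I_q.+1},
    (\sum_b x b) ^+ q <= q.+1%:R ^+ #|B| *
      \sum_(w : {ffun 'I_q -> B} | letter_count w == tau) \prod_i x (w i).
Proof.
have -> : (\sum_b x b) ^+ q = \sum_(w : {ffun 'I_q -> B}) \prod_i x (w i).
  by rewrite -(bigA_distr_bigA (fun _ b => x b)) prodr_const card_ord.
rewrite (partition_big (@letter_count q) xpredT) //=.
apply: contrapT => /forallNP noheavy.
pose S tau := \sum_(w : {ffun 'I_q -> B} | letter_count w == tau) \prod_i x (w i).
pose T := \sum_tau S tau.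
have small tau : q.+1%:R ^+ #|B| * S tau < T.
  by rewrite ltNge; apply/negP; exact: noheavy.
have cardT : #|{: {ffun B -> 'I_q.+1}}|%:R = q.+1%:R ^+ #|B| :> R.
  by rewrite card_ffun card_ord natrX.
have : \sum_(tau : {ffun B -> 'I_q.+1}) q.+1%:R ^+ #|B| * S tau <
       \sum_(tau : {ffun B -> 'I_q.+1}) T.
  apply: ltr_sum => //.
  by apply/hasP; exists [ffun=> ord0] => //; rewrite mem_index_enum.
by rewrite -mulr_sumr sumr_const -[ltRHS]mulr_natl cardT ltxx.
Qed.

Lemma codom_ffun_inj (T : Type) (q : nat) : injective (fun u : {ffun 'I_q -> T} => codom u).
Proof.
move=> u u' /= /eq_in_map h; apply/ffunP => i; apply: h.
by rewrite mem_enum.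
Qed.

Lemma hausdorff_measure_neq0 (f : E -> R -> R) (g : B -> R -> R) (n m : nat)
    (a b a' b' : R) (K : set (R * R)) (t : R) :
  (1 < m)%N -> (m <= n)%N -> (0 < #|E|)%N ->
  (forall e, similitude n%:R^-1 (f e)) ->
  (forall w, similitude m%:R^-1 (g w)) ->
  a' < b' -> (forall e x, a' < x < b' -> a' < f e x < b') ->
  (forall e e' x x', e != e' -> rho e = rho e' ->
     a' < x < b' -> a' < x' < b' -> f e x != f e' x') ->
  a < b -> (forall w y, a < y < b -> a < g w y < b) ->
  (forall w w' y y', w != w' -> a < y < b -> a < y' < b -> g w y != g w' y') ->
  compact K -> K !=set0 -> (forall e p, K p -> K (f e p.1, g (rho e) p.2)) ->
  0 <= t ->
  m%:R `^ t < \sum_b #|fibre b|%:R `^ (ln m%:R / ln n%:R) ->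
  hausdorff_measure t K <> 0%E.
Proof.
move=> m1 mn E0 sf sg ab' fJ fdis ab gI gdis cK K0 Kinv t0.
set beta := ln m%:R / ln n%:R => tlt.
have m0R : 0 < m%:R :> R by rewrite ltr0n ltnW.
have n0R : 0 < n%:R :> R by rewrite ltr0n (leq_trans _ mn) // ltnW.
have mt0 : 0 < m%:R `^ t by rewrite powR_gt0.
(* The blocks are long enough for the strict gap between [m^t] and the full sum to absorb the
   polynomial loss of the pigeonhole. *)
have [q [q0 qlt]] : exists q : nat, (0 < q)%N /\
    q.+1%:R ^+ #|B| < ((\sum_b #|fibre b|%:R `^ beta) / m%:R `^ t) ^+ q.
  by apply: expr_beats_polynomial; rewrite ltr_pdivlMr // mul1r.
have [tau heavy] := heavy_letter_count (fun b => #|fibre b|%:R `^ beta) q.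
pose r := (\prod_b #|fibre b| ^ tau b)%N.
pose W := {w : {ffun 'I_q -> B} | letter_count w == tau}.
have fibW (w : W) : #|[set u : {ffun 'I_q -> E} | [forall i, rho (u i) == val w i]]%SET| = r.
  by rewrite card_word_fibre (prod_letters _ (fun b => #|fibre b|)) (eqP (valP w)).
have prodW (w : {ffun 'I_q -> B}) : letter_count w == tau ->
    \prod_i #|fibre (w i)|%:R `^ beta = r%:R `^ beta :> R.
  move=> /eqP wtau; rewrite /r -wtau -(prod_letters w (fun b => #|fibre b|)).
  elim/big_rec2: _ => [|i y x _ ->]; first by rewrite powR1.
  by rewrite natrM powRM.
have sumW : \sum_(w : {ffun 'I_q -> B} | letter_count w == tau)
    \prod_i #|fibre (w i)|%:R `^ beta = #|{: W}|%:R * r%:R `^ beta :> R.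
  by rewrite (eq_bigr _ prodW) sumr_const card_sig mulr_natl.
move: heavy; rewrite sumW => heavy.
have big_t : (m ^ q)%:R `^ t < #|{: W}|%:R * r%:R `^ beta.
  move: qlt; rewrite expr_div_n ltr_pdivlMr ?exprn_gt0 // => qlt.
  have := lt_le_trans qlt heavy; rewrite ltr_pM2l ?exprn_gt0 //.
  by rewrite natrX -(powR_mulrn q (ltW m0R)) -(powR_mulrn q (powR_ge0 _ t))
    -!powRrM (mulrC t).
have WR0 : 0 < #|{: W}|%:R * r%:R `^ beta.
  by apply: le_lt_trans big_t; exact: powR_ge0.
have W0 : (0 < #|{: W}|)%N.
  by rewrite lt0n; apply/eqP => h; move: WR0; rewrite h mul0r ltxx.
have r0 : (0 < r)%N.
  rewrite lt0n; apply/eqP => h; move: WR0; rewrite h powR0 ?mulr0 ?ltxx //.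
  by have [beta0 _ _] := @log_ratio R _ _ m1 mn; rewrite gt_eqF.
have /card_gt0P[e0 _] := E0.
pose A (w : W) := enum [set u : {ffun 'I_q -> E} | [forall i, rho (u i) == val w i]]%SET.
have szA w : size (A w) = r by rewrite -cardE fibW.
(* Numbering the [r] blocks over each row word turns the subsystem into a product [W * 'I_r]; every
   list has length [r], so the default is never reached. *)
pose phi (x : W * 'I_r) : {ffun 'I_q -> E} := nth [ffun=> e0] (A x.1) x.2.
have phi_in w j : phi (w, j) \in A w by apply: mem_nth; rewrite szA.
have rho_phi x : map rho (codom (phi x)) = codom (val x.1).
  case: x => w j; rewrite /codom /image_mem -map_comp; apply: eq_map => i /=.
  by have := phi_in w j; rewrite mem_enum inE => /forallP/(_ i)/eqP.
apply: (@uniform_fibre_measure_neq0 R W 'I_r (fun x => word_map f (codom (phi x)))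
  (fun w => word_map g (codom (val w))) (n ^ q) (m ^ q) a b a' b') => //.
- by rewrite -(exp1n q) ltn_exp2r.
- by rewrite leq_exp2r.
- by rewrite card_ord.
- move=> x; rewrite natrX -exprVn -{1}(card_ord q) -(size_codom (phi x)).
  exact: word_map_similitude.
- move=> x; rewrite natrX -exprVn -{1}(card_ord q) -(size_codom (val x)).
  exact: word_map_similitude.
- by move=> x y; exact: (@word_map_in _ _ f [set y | a' < y < b']).
- move=> [w j] [w' j'] y y' ne /= ww' hy hy'; subst w'.
  apply: (@word_map_disjoint R _ _ rho f n%:R^-1 [set y | a' < y < b']) => //.
  + by rewrite invr_gt0.
  + by rewrite !size_codom.
  + apply: contra ne => /eqP/codom_ffun_inj/eqP.
    rewrite /phi nth_uniq ?szA ?enum_uniq //= => /eqP jj'.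
    by rewrite (val_inj jj').
  + by rewrite !rho_phi.
- by move=> x y; exact: (@word_map_in _ _ g [set y | a < y < b]).
- move=> w w' y y' ne hy hy'.
  apply: (@word_map_disjoint R _ unit (fun=> tt) g m%:R^-1 [set y | a < y < b]) => //.
  + by rewrite invr_gt0.
  + by move=> v v' z z' vv' _; exact: gdis.
  + by rewrite !size_codom.
  + by apply: contra ne => /eqP/codom_ffun_inj/val_inj/eqP.
  + by rewrite /codom /image_mem -!map_comp; apply: eq_map.
- move=> x p Kp; rewrite -rho_phi; exact: word_map_ifs.
(* Passing to blocks of length [q] leaves the exponent [beta] unchanged. *)
suff -> : ln (m ^ q)%:R / ln (n ^ q)%:R = beta :> R by rewrite card_ord.
rewrite !natrX (lnXn q m0R) (lnXn q n0R) -(mulr_natl (ln m%:R)) -(mulr_natl (ln n%:R)).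
by rewrite invfM mulrACA mulfV ?mul1r // pnatr_eq0 -lt0n.
Qed.

End Fibres.
End LowerBound.

(** * Upper bound *)

Section UpperBound.
Context {R : realType}.

(* McMullen's averaging: if the inequality failed at every step, the averages
   [S (kap j) / kap j] would drop by [eps] each time and become negative. *)
Lemma chain_good (S : nat -> R) (kap : nat -> nat) (beta eps A : R) (J : nat) :
  0 < eps -> 0 < beta -> beta <= 1 -> (forall j, (0 < kap j)%N) ->
  (forall j, (kap j)%:R <= beta * (kap j.+1)%:R) -> (forall i, 0 <= S i) ->
  S (kap 0%N) <= A * (kap 0%N)%:R -> A < J%:R * eps ->
  exists2 j, (j < J)%N &
    S (kap j) - beta * S (kap j.+1) <= eps * (kap j.+1)%:R.
Proof.
move=> eps0 beta0 beta1 kap0 kapS S0 SA AJ; apply: contrapT => bad.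
have bound j : (j <= J)%N -> S (kap j) <= (A - j%:R * eps) * (kap j)%:R.
  elim: j => [_|j IH jJ]; first by rewrite mul0r subr0.
  have {}IH := IH (ltnW jJ).
  have : eps * (kap j.+1)%:R < S (kap j) - beta * S (kap j.+1).
    by rewrite ltNge; apply/negP => h; apply: bad; exists j.
  have kj0 : 0 < (kap j)%:R :> R by rewrite ltr0n.
  have kj1 : 0 < (kap j.+1)%:R :> R by rewrite ltr0n.
  move: IH; rewrite -natr1; set G := A - j%:R * eps => IH lt1.
  have G0 : 0 <= G by rewrite -(pmulr_lge0 _ kj0) (le_trans (S0 _) IH).
  have h1 : G * (kap j)%:R <= G * (beta * (kap j.+1)%:R) by rewrite ler_wpM2l.
  have h2 : beta * (eps * (kap j.+1)%:R) <= eps * (kap j.+1)%:R.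
    by rewrite ler_piMl // mulr_ge0 // ltW.
  have -> : A - (j%:R + 1) * eps = G - eps by rewrite /G; ring.
  rewrite -(ler_pM2l beta0).
  have -> : beta * ((G - eps) * (kap j.+1)%:R) =
    G * (beta * (kap j.+1)%:R) - beta * (eps * (kap j.+1)%:R) by ring.
  by lra.
have := bound J (leqnn _); apply/negP; rewrite -ltNge.
apply: lt_le_trans (S0 _); rewrite pmulr_llt0 ?ltr0n //; lra.
Qed.

Lemma sum_tuple_prod {T : finType} (F : T -> R) (q : nat) :
  \sum_(w : q.-tuple T) \prod_(x <- w) F x = (\sum_x F x) ^+ q.
Proof.
elim: q => [|q IH].
  rewrite (big_pred1 [tuple]) ?big_nil // => w.
  by apply/esym/eqP; rewrite (tuple0 w).
rewrite exprS -IH big_distrlr /= pair_big /=.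
rewrite (reindex (fun x : T * q.-tuple T => [tuple of x.1 :: x.2])) /=.
  by apply: eq_bigr => -[x w] _; rewrite big_cons.
exists (fun w => (thead w, [tuple of behead w])) => [[x w] _ | w _] /=.
  by congr (_, _); apply: val_inj.
by rewrite [RHS]tuple_eta.
Qed.

(** A finite cover becomes a sequence when padded with empty sets, whose gauge is 0 even for t =
    0. *)
Lemma finite_covers_null (K : set (R * R)) (t : R) : 0 <= t ->
  (forall delta eta : R, 0 < delta -> 0 < eta ->
    exists (T : finType) (X : {set T}) (V : T -> set (R * R)) (d : T -> R),
    [/\ forall p, K p -> exists2 x, x \in X & V x p,
        forall x p r, V x p -> V x r -> Defs.edist p r <= d x,
        forall x, 0 <= d x <= delta &
        \sum_(x in X) d x `^ t <= eta]) ->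
  hausdorff_measure t K = 0%E.
Proof.
move=> t0 cov.
have prem0 (U : nat -> set (R * R)) : (0 <= \sum_(0 <= k <oo) hgauge t (U k))%E.
  by apply: nneseries_ge0 => k _ _; exact: hgauge_ge0.
have pre_ge0 delta : (0 <= hausdorff_premeasure t delta K)%E.
  by apply: le_ereal_inf_tmp => _ [U _ <-].
apply/eqP; rewrite eq_le; apply/andP; split; last first.
  by apply: le_trans (pre_ge0 1) _; apply: ereal_sup_ubound; exists 1 => //; exact: ltr01.
apply: ge_ereal_sup => _ [delta /= delta0 <-].
apply/lee_addgt0Pr => eta eta0; rewrite add0e.
have [T [X [V [d [KV dV d0 sumd]]]]] := cov delta eta delta0 eta0.
have hgauge0 : hgauge t (set0 : set (R * R)) = 0%E.
  by rewrite /hgauge ifT //; apply/asboolP.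
pose L := map V (enum X).
have sum_hgauge : ((\sum_(0 <= k <oo) hgauge t (nth set0 L k)) <= eta%:E)%E.
  rewrite (nneseries_split 0 (size L)) => [|k _]; last exact: hgauge_ge0.
  rewrite add0n eseries0 => [|k kL _]; last by rewrite nth_default.
  rewrite adde0 -(big_nth set0 xpredT (hgauge t)) big_map big_enum /=.
  apply: (@le_trans _ _ (\sum_(x in X) (d x `^ t)%:E)%E).
    apply: lee_sum => x _; apply: hgauge_le => //; last exact: dV.
    by case/andP: (d0 x).
  by rewrite sumEFin lee_fin.
apply: le_trans sum_hgauge; apply: ereal_inf_lbound.
exists (nth set0 L) => //; split=> [p /KV[x xX Vp]|k].
  exists (index x (enum X)) => //.
  by rewrite (nth_map x) ?index_mem ?mem_enum // nth_index ?mem_enum.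
have [kL|kL] := ltnP k (size L); last first.
  by rewrite nth_default // /diam setX0 image_set0 ereal_sup0 leNye.
have /mapP[x _ ->] := mem_nth set0 kL.
apply: ge_ereal_sup => _ [[p r] [/= Vp Vr] <-]; rewrite lee_fin.
by apply: le_trans (dV _ _ _ Vp Vr) _; case/andP: (d0 x).
Qed.

Lemma hausdorff_measure_eq0 {E B : finType} (rho : E -> B)
    (f : E -> R -> R) (g : B -> R -> R) (n m : nat) (K : set (R * R)) (s : R) :
  (1 < m)%N -> (m <= n)%N -> (forall b, (0 < #|fibre rho b|)%N) ->
  (forall e, similitude n%:R^-1 (f e)) ->
  (forall w, similitude m%:R^-1 (g w)) ->
  compact K -> K !=set0 ->
  (forall e p, K p -> K (f e p.1, g (rho e) p.2)) ->
  (forall p, K p -> exists e p', K p' /\ p = (f e p'.1, g (rho e) p'.2)) ->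
  0 <= s ->
  \sum_b #|fibre rho b|%:R `^ (ln m%:R / ln n%:R) < m%:R `^ s ->
  hausdorff_measure s K = 0%E.
Proof.
move=> m1 mn fib0 sf sg cK [p0 Kp0] Kinv Kdec s0.
set beta := ln m%:R / ln n%:R.
set Z := \sum_b _ => Zlt.
have m1R : 1 < m%:R :> R by rewrite ltr1n.
have n1R : 1 < n%:R :> R by rewrite ltr1n (leq_trans m1).
have m0R : 0 < m%:R :> R by rewrite (lt_trans _ m1R).
have n0R : 0 < n%:R :> R by rewrite (lt_trans _ n1R).
have [beta0 beta1 nbeta] : [/\ 0 < beta, beta <= 1 & n%:R `^ beta = m%:R]
  by exact: log_ratio.
have [e0 _] := Kdec p0 Kp0.
have [lam lam0 Klam] : exists2 lam : R, 0 <= lam & forall p, K p ->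
    `|p.1 - p0.1| <= lam /\ `|p.2 - p0.2| <= lam.
  have [C C0 KC] := compact_coord_bound cK.
  exists (C + C) => [|p /KC[p1 p2]]; first exact: addr_ge0.
  have [q1 q2] := KC _ Kp0.
  by split; apply: le_trans (ler_normB _ _) _; exact: lerD.
pose r b : R := #|fibre rho b|%:R.
have r1 b : 1 <= r b by rewrite ler1n.
have r0 b : 0 < r b by apply: lt_le_trans (r1 b).
have lnr0 b : 0 <= ln (r b) by rewrite ln_ge0.
pose A := ln (#|E|%:R : R).
have lnrA b : ln (r b) <= A.
  have rE : r b <= #|E|%:R by rewrite ler_nat max_card.
  by rewrite ler_ln ?posrE // (lt_le_trans (r0 b)).
have A0 : 0 <= A := le_trans (lnr0 (rho e0)) (lnrA _).
have Zpos : 0 < Z.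
  rewrite /Z (bigD1 (rho e0)) //= ltr_pwDl ?powR_gt0 //; first exact: r0.
  by apply: sumr_ge0 => b _; exact: powR_ge0.
(* Row [b] contributes [r b] equal terms, hence [r b] to the power [beta]; column letters and row
   letters thus both have total weight [Z]. *)
have ZE : \sum_e r (rho e) `^ (beta - 1) = Z.
  rewrite (partition_big rho xpredT) //=; apply: eq_bigr => b _.
  under eq_bigr => e /eqP -> do [].
  rewrite sumr_const powRD; last by rewrite (gt_eqF (r0 b)) implybT.
  rewrite powRN powRr1 1?ltW // -[LHS]mulr_natl.
  change (r b * (r b `^ beta / r b) = r b `^ beta).
  by rewrite mulrCA mulfV ?mulr1 // gt_eqF.
(* The square root splits the surplus of [m^s] over [Z] in two: one factor [gam^-k] is the weight
   threshold, the other makes the Hausdorff sums small. *)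
pose gam : R := Num.sqrt (m%:R `^ s / Z).
have mZ1 : 1 < m%:R `^ s / Z by rewrite ltr_pdivlMr // mul1r.
have gam2 : gam ^+ 2 = m%:R `^ s / Z by rewrite sqr_sqrtr // ltW // (lt_trans _ mZ1).
have gam1 : 1 < gam by rewrite -sqrtr1 ltr_sqrt // (lt_trans _ mZ1).
have gam0 : 0 < gam by apply: lt_trans gam1.
pose eps := ln gam.
have eps0 : 0 < eps by rewrite ln_gt0.
pose J := (Num.truncn (A / eps)).+1.
have AJ : A < J%:R * eps by rewrite -ltr_pdivrMr // truncnS_gt.
(* [lam + lam] compares two points through the centre of a cell, [n] covers the rounding of the
   column length, and 2 passes from coordinates to Euclidean distance. *)
pose c : R := 2 * ((lam + lam) * n%:R).
have c0 : 0 <= c by rewrite !mulr_ge0 ?addr_ge0 // ltW.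
apply: finite_covers_null => // delta eta delta0 eta0.
have mi : 0 <= (m%:R^-1 : R) < 1 by rewrite invr_ge0 ltW //= invf_lt1.
have gi : 0 <= gam^-1 < 1 by rewrite invr_ge0 ltW //= invf_lt1.
pose C := J%:R * c `^ s.
have C0 : 0 <= C by rewrite mulr_ge0 // powR_ge0.
have [k1 k10 hk1] := exprn_eventually_lt 1 mi (divr_gt0 delta0 (ltr_wpDl c0 ltr01)).
have [k0 k01 hk0] := exprn_eventually_lt k1 gi (divr_gt0 eta0 (ltr_wpDl C0 ltr01)).
have small_c k : (k0 <= k)%N -> c * m%:R^-1 ^+ k <= delta.
  move=> kk; apply: (@le_trans _ _ ((c + 1) * m%:R^-1 ^+ k1)); last first.
    by rewrite mulrC -ler_pdivlMr ?ltW // ltr_wpDl.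
  case/andP: mi => ge0 /ltW le1.
  apply: ler_pM => //; first by rewrite lerDl.
  by apply: ler_wiXn2l => //; exact: leq_trans kk.
have small_eta k : (k0 <= k)%N -> C * gam^-1 ^+ k <= eta.
  move=> kk; apply: (@le_trans _ _ ((C + 1) * gam^-1 ^+ k0)); last first.
    by rewrite mulrC -ler_pdivlMr ?ltW // ltr_wpDl.
  case/andP: gi => ge0 /ltW le1.
  apply: ler_pM => //; [exact: exprn_ge0|by rewrite lerDl|].
  by apply: ler_wiXn2l.
(* A square of stage [j] has [kap j] column letters and [kap j.+1] row letters, the latter being the
   least integer above [kap j / beta]. *)
pose kap j := iter j (fun k => (Num.truncn (k%:R / beta)).+1) k0.
have kapS_gt j : (kap j)%:R < beta * (kap j.+1)%:R.
  by rewrite mulrC -ltr_pdivrMr // truncnS_gt.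
have kapS_le j : beta * (kap j.+1)%:R <= (kap j).+1%:R.
  have /andP[h _] : (Num.truncn ((kap j)%:R / beta))%:R <= (kap j)%:R / beta < (Num.truncn ((kap j)%:R / beta)).+1%:R.
    by apply: truncn_itv; rewrite divr_ge0 // ltW.
  rewrite /= -/(kap j) -[X in beta * X]natr1 mulrDr mulr1 -natr1 lerD //.
  by rewrite mulrC -ler_pdivlMr.
have kap_mono j : (kap j < kap j.+1)%N.
  rewrite -(ltr_nat R) (lt_le_trans (kapS_gt j)) // ler_piMl //.
have kap_le i j : (i <= j)%N -> (kap i <= kap j)%N.
  by apply: (homo_leq leqnn leq_trans) => {i j} i; exact: ltnW.
have kap_gt0 j : (0 < kap j)%N.
  by rewrite (leq_trans _ (kap_le 0%N j _)) //= (leq_trans k10).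
have decomp N p : K p -> exists e p', [/\ size e = N, K p' &
    p = (word_map f e p'.1, word_map g (map rho e) p'.2)].
  elim: N p => [|N IH] p Kp; first by exists [::], p; split=> //; case: (p).
  have [e [p1 [Kp1 ->]]] := Kdec p Kp.
  by have [e' [p2 [<- Kp2 ->]]] := IH p1 Kp1; exists (e :: e'), p2.
have prod_powR (l : seq B) x :
    \prod_(b <- l) r b `^ x = expR (x * \sum_(b <- l) ln (r b)).
  elim: l => [|b l IH]; first by rewrite !big_nil mulr0 expR0.
  by rewrite !big_cons IH mulrDr expRD /powR gt_eqF.
pose w j (x : (kap j).-tuple E * (kap j.+1 - kap j).-tuple B) : R :=
  \prod_(e <- x.1) r (rho e) `^ (beta - 1) * \prod_(b <- x.2) r b `^ beta.
have sum_w j : \sum_x w j x = Z ^+ kap j.+1.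
  rewrite -[X in Z ^+ X](subnKC (kap_le j j.+1 (leqnSn _))) exprD.
  rewrite -[X in X ^+ _ * _]ZE -!sum_tuple_prod.
  by rewrite big_distrlr /= pair_big.
have w0 j x : 0 <= w j x.
  by rewrite mulr_ge0 ?prodr_ge0 // => *; exact: powR_ge0.
pose T := {j : 'I_J & ((kap j).-tuple E * (kap j.+1 - kap j).-tuple B)%type}.
(* The weights of one stage add up to Z^k with [k = kap j.+1], so at most (Z gam)^k squares pass
   this threshold. *)
pose X := [set x : T | gam^-1 ^+ kap (tag x).+1 <= w _ (tagged x)]%SET.
(* All of [K] lies within [lam] of [p0] in each coordinate, so the image of [K] under a word lies
   within [lam] times the contraction of the image of [p0]. *)
pose V (x : T) := [set p : R * R |
  `|p.1 - word_map f (tagged x).1 p0.1| <= lam * n%:R^-1 ^+ kap (tag x) /\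
  `|p.2 - word_map g (map rho (tagged x).1 ++ (tagged x).2) p0.2|
     <= lam * m%:R^-1 ^+ kap (tag x).+1].
exists T, X, V, (fun x : T => c * m%:R^-1 ^+ kap (tag x).+1); split.
(* An address of length [kap J] has enough letters for every stage below [J]. *)
- move=> p Kp; have [e [p' [sz Kp' ->]]] := decomp (kap J) p Kp.
  pose S i := \sum_(b <- take i (map rho e)) ln (r b).
  have S0 i : 0 <= S i by apply: sumr_ge0.
  have SA : S (kap 0%N) <= A * (kap 0%N)%:R.
    apply: (@le_trans _ _ (\sum_(b <- take (kap 0%N) (map rho e)) A)).
      exact: ler_sum.
    rewrite big_const_seq count_predT iter_addr_0 -[leLHS]mulr_natr ler_wpM2l //.
    by rewrite ler_nat size_take_min geq_minl.
  have [j jJ good] := chain_good eps0 beta0 beta1 kap_gt0 (fun j => ltW (kapS_gt j)) S0 SA AJ.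
  pose L := kap j; pose k := kap j.+1.
  have Lk : (L <= k)%N by exact: kap_le.
  have ke : (k <= size e)%N by rewrite sz kap_le.
  have szt : size (take L e) == L by rewrite size_takel // (leq_trans Lk).
  have szv : size (map rho (take (k - L) (drop L e))) == (k - L)%N.
    by rewrite size_map size_takel // size_drop leq_sub2r.
  have catv : map rho (take L e) ++ map rho (take (k - L) (drop L e)) =
      map rho (take k e).
    by rewrite -map_cat -{2}(subnKC Lk) takeD.
  exists (existT _ (Ordinal jJ) (Tuple szt, Tuple szv)).
    (* The logarithm of the weight is (beta - 1) S(L) + beta (S(k) - S(L)) = beta S(k) - S(L), which
       [good] bounds below by - eps k. *)
    rewrite inE /= /w /= -(big_map rho xpredT (fun b => r b `^ (beta - 1))).
    rewrite !prod_powR -expRD -/k.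
    have -> : gam^-1 ^+ k = expR (- (eps * k%:R)).
      by rewrite expRN expRM_natr /eps lnK // exprVn.
    rewrite ler_expR; move: good; rewrite /S -!map_take -/k -/L -catv big_cat /=.
    by lra.
  split=> /=.
    rewrite -{1}(cat_take_drop L e) word_map_cat.
    have := @word_map_similitude R E f _ (take L e) sf; rewrite (eqP szt) => sim.
    rewrite (similitude_dist _ _ sim) mulrC ler_wpM2r ?exprn_ge0 ?invr_ge0 //.
    by have [] := Klam _ (word_map_ifs (drop L e) Kinv Kp').
  rewrite catv -{1}(cat_take_drop k e) map_cat word_map_cat.
  have := @word_map_similitude R B g _ (map rho (take k e)) sg.
  rewrite size_map size_takel // => sim.
  rewrite (similitude_dist _ _ sim) mulrC ler_wpM2r ?exprn_ge0 ?invr_ge0 //.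
  by have [] := Klam _ (word_map_ifs (drop k e) Kinv Kp').
- move=> [j x] p q [/= p1 p2] [/= q1 q2].
  have nm : n%:R^-1 ^+ kap j <= n%:R * m%:R^-1 ^+ kap j.+1 :> R.
    rewrite !exprVn ler_pdivlMr ?exprn_gt0 // mulrC ler_pdivrMr ?exprn_gt0 //.
    rewrite -exprS -{1}nbeta -(powR_mulrn _ (powR_ge0 _ _)) -(powR_mulrn _ (ltW n0R)).
    by rewrite -powRrM; apply: ler_powR => //; exact: ltW.
  have mm : m%:R^-1 ^+ kap j.+1 <= n%:R * m%:R^-1 ^+ kap j.+1 :> R.
    by rewrite ler_peMl ?exprn_ge0 ?invr_ge0 // ltW.
  have tri (u v z h : R) : `|u - z| <= lam * h -> `|v - z| <= lam * h ->
      h <= n%:R * m%:R^-1 ^+ kap j.+1 ->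
      `|u - v| <= (lam + lam) * n%:R * m%:R^-1 ^+ kap j.+1.
    move=> uz vz hle; rewrite -mulrA mulrDl.
    have -> : u - v = (u - z) - (v - z) by ring.
    apply: le_trans (ler_normB _ _) _; apply: lerD.
      by apply: le_trans uz _; rewrite ler_wpM2l.
    by apply: le_trans vz _; rewrite ler_wpM2l.
  rewrite /c -mulrA; apply: edist_le_coord.
    exact: tri p1 q1 nm.
  exact: tri p2 q2 mm.
- move=> [j x] /=; rewrite mulr_ge0 ?exprn_ge0 ?invr_ge0 //=.
  by apply: small_c; exact: (kap_le 0%N _.+1 (leq0n _)).
have scale k : (c * m%:R^-1 ^+ k) `^ s = c `^ s * Z ^- k * gam^-1 ^+ k * gam^-1 ^+ k.
  rewrite powRM ?exprn_ge0 ?invr_ge0 //.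
  have -> : (m%:R^-1 ^+ k) `^ s = (m%:R `^ s) ^- k.
    rewrite exprVn -(powR_inv1 (exprn_ge0 k (ltW m0R))) -powRrM mulN1r powRN.
    congr (_ ^-1); rewrite -(powR_mulrn k (ltW m0R)) -(powR_mulrn k (powR_ge0 _ _)).
    by rewrite -!powRrM mulrC.
  have -> : m%:R `^ s = Z * gam ^+ 2 by rewrite gam2 mulrC divfK // gt_eqF.
  by rewrite exprMn invfM !exprVn expr2 exprMn invfM !mulrA.
pose F (j : 'I_J) := \sum_(x | gam^-1 ^+ kap j.+1 <= w j x) (c * m%:R^-1 ^+ kap j.+1) `^ s.
rewrite (_ : \sum_(x in X) _ = \sum_j F j); last first.
  rewrite /F sig_big_dep /=; apply: eq_big => [[j x]|//].
  by rewrite inE.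
(* On [X] one factor [gam^-k] is at most the weight; replacing it and summing all weights to Z^k
   cancels Z^-k, and the other factor [gam^-k] remains. *)
have Fle j : F j <= c `^ s * gam^-1 ^+ k0.
  apply: (@le_trans _ _ (c `^ s * Z ^- kap j.+1 * gam^-1 ^+ kap j.+1 * \sum_x w j x)).
    rewrite mulr_sumr [leRHS](bigID (fun x => gam^-1 ^+ kap j.+1 <= w j x)) /=.
    have cZ0 : 0 <= c `^ s * Z ^- kap j.+1 * gam^-1 ^+ kap j.+1.
      by rewrite !mulr_ge0 ?powR_ge0 ?invr_ge0 ?exprn_ge0 ?invr_ge0 // ltW.
    rewrite -[leLHS]addr0 lerD //; last by apply: sumr_ge0 => x _; rewrite mulr_ge0.
    by apply: ler_sum => x wx; rewrite scale ler_wpM2l.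
  rewrite sum_w mulrAC -(mulrA _ _ (Z ^+ _)) mulVf ?mulr1 ?expf_neq0 ?gt_eqF //.
  rewrite ler_wpM2l ?powR_ge0 //; case/andP: gi => g0 /ltW g1.
  by rewrite ler_wiXn2l // (kap_le 0%N _.+1 (leq0n _)).
apply: (@le_trans _ _ (\sum_(j < J) c `^ s * gam^-1 ^+ k0)); first exact: ler_sum.
rewrite sumr_const card_ord -mulr_natl mulrA; exact: small_eta.
Qed.

End UpperBound.

(** * Reflected carpets *)

Section Dimension.
Context {R : realType}.

(** With [Z] the sum over rows, the measure of exponent [s] vanishes when m^s > Z and does not when
    m^s < Z, so the infimum sits at log Z / log m. *)
Lemma hausdorff_dim_ifs {E B : finType} (rho : E -> B)
    (f : E -> R -> R) (g : B -> R -> R) (n m : nat) (a b a' b' : R)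
    (K : set (R * R)) :
  (1 < m)%N -> (m <= n)%N -> (forall b, (0 < #|fibre rho b|)%N) ->
  (forall e, similitude n%:R^-1 (f e)) ->
  (forall w, similitude m%:R^-1 (g w)) ->
  a' < b' -> (forall e x, a' < x < b' -> a' < f e x < b') ->
  (forall e e' x x', e != e' -> rho e = rho e' ->
     a' < x < b' -> a' < x' < b' -> f e x != f e' x') ->
  a < b -> (forall w y, a < y < b -> a < g w y < b) ->
  (forall w w' y y', w != w' -> a < y < b -> a < y' < b -> g w y != g w' y') ->
  compact K -> K !=set0 -> (forall e p, K p -> K (f e p.1, g (rho e) p.2)) ->
  (forall p, K p -> exists e p', K p' /\ p = (f e p'.1, g (rho e) p'.2)) ->
  hausdorff_dim K =
    ((ln m%:R)^-1 * ln (\sum_b #|fibre rho b|%:R `^ (ln m%:R / ln n%:R)))%:E.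
Proof.
move=> m1 mn fib0 sf sg ab' fJ fdis ab gI gdis cK [p0 Kp0] Kinv Kdec.
set Z := \sum_b _.
have [e0 _] := Kdec p0 Kp0.
have m1R : 1 < m%:R :> R by rewrite ltr1n.
have m0R : 0 < m%:R :> R by rewrite (lt_trans _ m1R).
have lnm : 0 < ln (m%:R : R) by rewrite ln_gt0.
have Z1 : 1 <= Z.
  rewrite /Z (bigD1 (rho e0)) //=.
  apply: (@le_trans _ _ (#|fibre rho (rho e0)|%:R `^ (ln m%:R / ln n%:R))).
    rewrite -[leLHS](powRr0 #|fibre rho (rho e0)|%:R).
    apply: ler_powR; first by rewrite ler1n.
    by have [/ltW] := @log_ratio R _ _ m1 mn.
  by rewrite lerDl sumr_ge0 // => b0 _; exact: powR_ge0.
have Z0 : 0 < Z by rewrite (lt_le_trans _ Z1).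
have powm (s : R) : m%:R `^ s = expR (s * ln m%:R) by rewrite /powR gt_eqF.
have powZ : Z = expR (ln Z) by rewrite lnK.
apply/eqP; rewrite eq_le; apply/andP; split.
  apply/lee_addgt0Pr => eps eps0.
  apply: ereal_inf_lbound; exists ((ln m%:R)^-1 * ln Z + eps) => //.
  have s0 : 0 <= (ln m%:R)^-1 * ln Z + eps.
    by rewrite addr_ge0 ?(ltW eps0) // mulr_ge0 ?invr_ge0 ?(ltW lnm) // ln_ge0.
  split=> //.
  apply: (@hausdorff_measure_eq0 R E B rho f g n m) => //; first by exists p0.
  rewrite -/Z powm {1}powZ ltr_expR mulrDl mulrAC mulVf ?mul1r ?gt_eqF //.
  by rewrite ltrDl mulr_gt0.
apply: le_ereal_inf_tmp => _ [s [s0 Hs] <-]; rewrite lee_fin leNgt.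
apply/negP => slt.
apply: (@hausdorff_measure_neq0 R E B rho f g n m a b a' b' K s) => //.
- by apply/card_gt0P; exists e0.
- by exists p0.
- by rewrite -/Z powm powZ ltr_expR -ltr_pdivlMr // mulrC.
Qed.

Lemma sign_map_similitude (N k : nat) (b : bool) :
  similitude N%:R^-1 (@sign_map R N k b).
Proof.
exists ((-1) ^+ b / N%:R), ((if b then k.+1 else k)%:R / N%:R).
split; last by move=> x; rewrite /sign_map mulrDl mulrAC.
by rewrite normrM normrX normrN1 expr1n mul1r ger0_norm // invr_ge0.
Qed.

Lemma row_branchE (m : nat) (js : 'I_m * bool) (y : R) :
  row_branch js y = sign_map m js.1 js.2 y.
Proof.
rewrite /row_branch /sign_map; case: js => j [] /=.
  by rewrite expr1 mulN1r addrC.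
by rewrite expr0 mul1r.
Qed.

(** The offset k + 1 of a reflected branch puts its image in the same grid cell as the unreflected
    one; different cells then give disjoint columns. *)
Lemma sign_map_cell (N k : nat) (b : bool) (x : R) : (0 < N)%N -> 0 < x < 1 ->
  k%:R < N%:R * sign_map N k b x < k.+1%:R.
Proof.
move=> N0 /andP[x0 x1]; rewrite /sign_map mulrC divfK ?pnatr_eq0 -?lt0n //.
by case: b; rewrite ?expr1 ?expr0 -!natr1; apply/andP; split; lra.
Qed.

Lemma sign_map_unit_interval (N k : nat) (b : bool) (x : R) : (k < N)%N ->
  0 < x < 1 -> 0 < sign_map N k b x < 1.
Proof.
move=> kN x01; have N0 : (0 < N)%N by exact: leq_ltn_trans kN.
have N0R : 0 < N%:R :> R by rewrite ltr0n.
have /andP[lo hi] := sign_map_cell k b N0 x01.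
rewrite -(pmulr_rgt0 _ N0R) (le_lt_trans _ lo) //=.
by rewrite -(ltr_pM2l N0R) mulr1 (lt_le_trans hi) // ler_nat.
Qed.

Lemma sign_map_disjoint (N k k' : nat) (b b' : bool) (x x' : R) : (0 < N)%N ->
  k != k' -> 0 < x < 1 -> 0 < x' < 1 -> sign_map N k b x != sign_map N k' b' x'.
Proof.
move=> N0; wlog kk' : k k' b b' x x' / (k < k')%N.
  move=> wh ne hx hx'; have [kk'|k'k|/eqP] := ltngtP k k'; first exact: wh.
    by rewrite eq_sym wh // eq_sym.
  by rewrite (negPf ne).
move=> _ hx hx'; have /andP[_ hi] := sign_map_cell k b N0 hx.
have /andP[lo _] := sign_map_cell k' b' N0 hx'.
apply/eqP => e; move: lo; rewrite -e; apply/negP; rewrite -leNgt.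
by rewrite (le_trans (ltW hi)) // ler_nat.
Qed.

End Dimension.

(** * The digits of a carpet, grouped by signed row branch *)

Section CarpetSystem.
Context (n m : nat) (D : {set 'I_n * 'I_m}) (eta : 'I_n * 'I_m -> bool).

Lemma digit_row_active (d : {d | d \in D}) :
  ((val d).2, eta (val d)) \in active_branches D eta.
Proof.
rewrite inE; apply/card_gt0P; exists (val d).1.
by rewrite inE -surjective_pairing (valP d) eqxx.
Qed.

(** Taking only active branches as targets makes every fibre non-empty. *)
Definition digit_row (d : {d | d \in D}) : {js | js \in active_branches D eta} :=
  exist (fun js => js \in active_branches D eta) _ (digit_row_active d).

(** Within one signed row a digit is determined by its column. *)
Lemma card_fibre_digit_row b : #|fibre digit_row b| = row_count D eta (val b).
Proof.
have val_fibre d : d \in fibre digit_row b -> ((val d).2, eta (val d)) = val b.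
  by rewrite inE => /eqP <-.
have inj : {in fibre digit_row b &, injective (fun d => (val d).1)}.
  move=> d d' /val_fibre db /val_fibre d'b dd'; apply: val_inj.
  move: db; rewrite -d'b => -[h _].
  by rewrite [LHS]surjective_pairing [RHS]surjective_pairing dd' h.
rewrite -(card_in_imset inj); apply: eq_card => i; rewrite inE.
apply/imsetP/andP => [[d /val_fibre <- ->]|[iD /eqP ib]].
  by rewrite -surjective_pairing eqxx (valP d).
exists (exist (fun d => d \in D) _ iD) => //; rewrite inE; apply/eqP/val_inj => /=.
by rewrite ib -surjective_pairing.
Qed.

End CarpetSystem.

Theorem corollary4p1 (R : realType) (n m : nat) (hm : (2 <= m)%N)
  (hmn : (m < n)%N) (D : {set 'I_n * 'I_m}) (hD : D != finset.set0)
  (sigma eta : 'I_n * 'I_m -> bool) (K : set (R * R))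
  (hK : is_attractor D (carpet_map sigma eta) K)
  (hI : exists a b : R,
    [/\ a < b,
        `]a, b[ `<=` `]0, 1[,
        forall js, js \in active_branches D eta ->
          row_branch js @` `]a, b[ `<=` `]a, b[
      & trivIset [set` active_branches D eta]
          (fun js => row_branch js @` `]a, b[)]) :
  let beta : R := ln m%:R / ln n%:R in
  hausdorff_dim K =
    ((ln m%:R)^-1 *
     ln (\sum_(js in active_branches D eta)
           (row_count D eta js)%:R `^ beta))%:E.
Proof.
move=> beta; have [K0 cK Keq] := hK; have [a [b [ab _ gI gdis]]] := hI.
pose f (d : {d | d \in D}) := @sign_map R n (val d).1 (sigma (val d)).
pose g (js : {js | js \in active_branches D eta}) := @row_branch R m (val js).
have SdE d p : carpet_map sigma eta (val d) p = (f d p.1, g (digit_row eta d) p.2).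
  by rewrite /carpet_map /g row_branchE.
have n0 : (0 < n)%N by exact: leq_ltn_trans hmn.
(* Rows are separated on the given interval []a, b[]; columns within a row are separated on []0, 1[]
   by the grid itself. *)
rewrite (@hausdorff_dim_ifs R _ _ (digit_row eta) f g n m a b 0 1 K) //.
- rewrite [in RHS]big_sub; do 3 f_equal; apply: eq_bigr => js _.
  by rewrite card_fibre_digit_row.
- exact: ltnW.
- by move=> js; rewrite card_fibre_digit_row; have := valP js; rewrite inE.
- by move=> d; exact: sign_map_similitude.
- move=> js; have [u [t [uE gE]]] := @sign_map_similitude R m (val js).1 (val js).2.
  by exists u, t; split=> // y; rewrite /g row_branchE.
- by move=> d x; apply: sign_map_unit_interval; exact: ltn_ord.
- move=> d d' x x' ne /(congr1 val) [row _]; apply: sign_map_disjoint => //.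
  apply: contra ne => /eqP col; apply/eqP/val_inj.
  by rewrite [LHS]surjective_pairing [RHS]surjective_pairing row (val_inj col).
- move=> js y hy; have := gI _ (valP js) (g js y); rewrite /= in_itv /=; apply.
  by exists y => //=; rewrite in_itv.
- move=> js js' y y' ne hy hy'; apply/eqP => e.
  have /(_ (valP js) (valP js')) := gdis (val js) (val js').
  suff meet : (row_branch (val js) @` `]a, b[) `&` (row_branch (val js') @` `]a, b[) !=set0.
    by move=> /(_ meet) /val_inj; apply/eqP.
  exists (g js y); split; [exists y|exists y'] => //=; by rewrite in_itv.
- move=> d p Kp; rewrite -SdE Keq; exists (val d); first exact: (valP d).
  by exists p.
- move=> p; rewrite {1}Keq => -[d dD [p' Kp' <-]].
  by exists (exist (fun d => d \in D) d dD), p'; split=> //; rewrite -SdE.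
Qed.
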